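(* For $\sigma>0$ let $\mathcal H_\sigma$ denote the RKHS of the Gaussian kernel $k_\sigma(x,y) = \exp(-\|x-y\|^2/(2\sigma^2))$ on $\mathbb R^d$, with norm $\|\cdot\|_\sigma$. Let $\mathbb P$ be a probability distribution on $\mathbb R^d$, let $x_1,\dots,x_n$ be i.i.d. from $\mathbb P$, and let $\hat{\mathbb P}_n = \frac1n\sum_i \delta_{x_i}$. Let $h$ be a target function satisfying $\|h^2\|_{\sigma/\sqrt2} \leq \Lambda_{h^2}$ and $\|h\|_\sigma \leq \Lambda_h$. For a distribution $\mathbb Q$ write $R_{\mathbb Q}(f) = \mathbb{E}_{x\sim\mathbb Q}[(f(x)-h(x))^2]$. Then for any $\delta>0$, with probability at least $1-\delta$, the following holds simultaneously for all functions $f$ satisfying $\|f^2\|_{\sigma/\sqrt2} \leq \Lambda_{f^2}$ and $\|f\|_\sigma \leq \Lambda_f$: $$R_{\mathbb P}(f) \leq R_{\hat{\mathbb P}_n}(f) + \frac{2}{\sqrt n}\left(1 + \sqrt{\frac{\log(1/\delta)}{2}}\right)\left(\Lambda_{f^2} + \Lambda_{h^2} + 2\Lambda_f\Lambda_h\right).$$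
   Context: Here $f^2, h^2$ denote pointwise squares, and the condition $\|f^2\|_{\sigma/\sqrt2}\le\Lambda_{f^2}$ includes $f^2 \in \mathcal H_{\sigma/\sqrt2}$. *)

(* Defs.v *)
From HB Require Import structures.
From mathcomp Require Import all_boot all_order all_algebra.
From mathcomp Require Import all_classical all_reals all_analysis.
Set Implicit Arguments. Unset Strict Implicit. Unset Printing Implicit Defensive.
Import Order.TTheory GRing.Theory Num.Theory.
Import numFieldNormedType.Exports.
Local Open Scope classical_set_scope.
Local Open Scope ring_scope.

Section Defs.
Variable R : realType.

(** Squared Euclidean distance on R^d, points of R^d being d.-tuple R
    (which carries the product sigma-algebra of MathComp-Analysis). *)
Definition sqdist (d : nat) (x y : d.-tuple R) : R :=
  \sum_(i < d) (tnth x i - tnth y i) ^+ 2.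

Definition gauss_kernel (d : nat) (sigma : R) (x y : d.-tuple R) : R :=
  expR (- sqdist x y / (2 * sigma ^+ 2)).

(** Moore--Aronszajn construction of the RKHS of a kernel k on T.
    Elements of the pre-Hilbert space H_0 = span{k(x,.)} are represented
    by finite lists of (coefficient, centre) pairs. *)
Variable T : Type.
Variable k : T -> T -> R.

Definition comb_eval (c : seq (R * T)) (x : T) : R :=
  \sum_(p <- c) p.1 * k p.2 x.

Definition comb_sqnorm (c : seq (R * T)) : R :=
  \sum_(p <- c) \sum_(q <- c) p.1 * q.1 * k p.2 q.2.

Definition comb_sub (c c' : seq (R * T)) : seq (R * T) :=
  c ++ [seq (- p.1, p.2) | p <- c'].

(** [rkhs_norm_le f L] : f belongs to the RKHS H_k and ||f||_{H_k} <= L.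
    H_k is the set of functions that are pointwise limits of H_0-Cauchy
    sequences, and ||f|| = lim ||f_m||_{H_0} (independent of the sequence). *)
Definition rkhs_norm_le (f : T -> R) (L : R) : Prop :=
  exists u : nat -> seq (R * T),
    (forall x, comb_eval (u m) x @[m --> \oo] --> f x) /\
    (forall e : R, 0 < e -> exists N : nat, forall m p : nat,
        (N <= m)%N -> (N <= p)%N ->
        Num.sqrt (comb_sqnorm (comb_sub (u m) (u p))) <= e) /\
    (forall e : R, 0 < e -> exists N : nat, forall m : nat,
        (N <= m)%N -> Num.sqrt (comb_sqnorm (u m)) <= L + e).
End Defs.

Definition gauss_rkhs_norm_le (R : realType) (d : nat) (sigma : R)
    (f : d.-tuple R -> R) (L : R) : Prop :=
  rkhs_norm_le (@gauss_kernel R d sigma) f L.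

Section Indep.
Local Open Scope ereal_scope.
Definition mutually_independent (R : realType) (dO : measure_display)
    (Omega : measurableType dO) (Pr : probability Omega R)
    (dT : measure_display) (T : measurableType dT) (n : nat)
    (X : 'I_n -> Omega -> T) : Prop :=
  forall (J : {set 'I_n}) (B : 'I_n -> set T),
    (forall i, measurable (B i)) ->
    Pr (\bigcap_(i in [set i | i \in J]) (X i @^-1` B i)) =
    \prod_(i in J) Pr (X i @^-1` B i).

Definition identically_distributed (R : realType) (dO : measure_display)
    (Omega : measurableType dO) (Pr : probability Omega R)
    (dT : measure_display) (T : measurableType dT) (P : probability T R)
    (n : nat) (X : 'I_n -> Omega -> T) : Prop :=
  forall (i : 'I_n) (B : set T), measurable B -> Pr (X i @^-1` B) = P B.
End Indep.

(* Main.v *)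
Require Import Defs.
From HB Require Import structures.
From mathcomp Require Import all_boot all_order all_algebra.
From mathcomp Require Import all_classical all_reals all_analysis measurable_realfun.
From mathcomp Require Import ring lra.
Set Implicit Arguments. Unset Strict Implicit. Unset Printing Implicit Defensive.
Import Order.TTheory GRing.Theory Num.Theory.
Import numFieldNormedType.Exports.
Local Open Scope classical_set_scope.
Local Open Scope ring_scope.

(**
  On pairs of points, the product kernel [K((x,y),(x',y')) = k_sigma(x,x') k_sigma(y,y')]
  restricts to [k_(sigma / sqrt 2)] on the diagonal. Hence [f^2], [h^2] and the product
  [f h] are all evaluations, on the diagonal, of vectors of the RKHS of [K], the last one of
  norm at most [|f| |h|] (that of a pure tensor), and [(f - h)^2] comes from a vector of norm
  at most [M = Lf2 + Lh2 + 2 Lf Lh]. By Cauchy-Schwarz the gap between the two risks is at most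
  [M / n] times the norm of [sum_i (k_(x_i) - mu_P)], where [mu_P] is the mean embedding of [P].
  Replacing one sample moves this norm by at most [sqrt 2], and its second moment is at most
  [n], so the martingale argument of Azuma and McDiarmid bounds its upper tail.
*)

(** * Positive definite kernels *)

(** Because the whole loss is one vector, a single tail bound covers [f^2], [f h], [h^2] and every
    [f] at once: [delta] is not split, and no supremum over an uncountable class has to be
    measurable. No completed Hilbert space is built. Vectors are finite combinations of kernel
    functions, extended by real multiples of mu_P, under a form that is only known to be
    semidefinite. A function [f] enters through an approximating sequence whose norms may exceed the
    prescribed radius by a slack [e]; since the event does not depend on [e], the slack can tend to
    0 on it. The constants: put L = ln(1/delta). A Hoeffding exponent l^2 c^2 / 4 with c = sqrt 2
    gives a deviation sqrt(2 n L) above the mean, which is at most sqrt n. The stated bound,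
    multiplied by n / M, equals 2 sqrt n + sqrt(2 n L), so the exponent l^2 c^2 / 4 suffices in
    place of the sharp l^2 c^2 / 8. *)

(** The quadratic is evaluated at its minimiser -B/C. The case C = 0 does occur, the forms below
    being semidefinite; there a nonzero B would let the remaining affine function take the value
    -1. *)
Lemma discriminant_le (R : realFieldType) (A B C : R) : 0 <= A -> 0 <= C ->
  (forall t, 0 <= A + 2 * t * B + t ^+ 2 * C) -> B ^+ 2 <= A * C.
Proof.
move=> A0 C0 q0; have [C1|C1] := eqVneq C 0; last first.
  have Cgt : 0 < C by rewrite lt_def C1.
  have := q0 (- B / C); rewrite -(pmulr_lge0 _ Cgt).
  by rewrite (_ : (_ + _ + _) * C = A * C - B ^+ 2) ?subr_ge0 //; field.
have [->|B1] := eqVneq B 0; first by rewrite expr0n mulr_ge0.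
have := q0 (- (A + 1) / (2 * B)).
by rewrite C1 mulr0 addr0 (_ : A + _ = -1) ?oppr_ge0 ?ler10 //; field.
Qed.

Section PositiveKernels.
Variables (R : realType) (S : Type).
Implicit Types (K L : S -> S -> R) (c w : seq (R * S)).

Definition comb_ip K c w : R :=
  \sum_(p <- c) \sum_(q <- w) p.1 * q.1 * K p.2 q.2.

Definition comb_scale (a : R) c : seq (R * S) := [seq (a * p.1, p.2) | p <- c].

Definition pos_def K : Prop := forall c, 0 <= comb_sqnorm K c.

Lemma comb_ip_catl K c c' w : comb_ip K (c ++ c') w = comb_ip K c w + comb_ip K c' w.
Proof. by rewrite /comb_ip big_cat. Qed.

Lemma comb_ip_catr K c w w' : comb_ip K c (w ++ w') = comb_ip K c w + comb_ip K c w'.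
Proof. by rewrite /comb_ip -big_split /=; apply: eq_bigr => p _; rewrite big_cat. Qed.

Lemma comb_ip_scalel K a c w : comb_ip K (comb_scale a c) w = a * comb_ip K c w.
Proof.
rewrite /comb_ip big_map mulr_sumr; apply: eq_bigr => p _ /=.
by rewrite mulr_sumr; apply: eq_bigr => q _; rewrite !mulrA.
Qed.

Lemma comb_ip_scaler K a c w : comb_ip K c (comb_scale a w) = a * comb_ip K c w.
Proof.
rewrite /comb_ip mulr_sumr; apply: eq_bigr => p _ /=.
rewrite big_map mulr_sumr; apply: eq_bigr => q _ /=; ring.
Qed.

Lemma comb_ipC K c w : (forall s t, K s t = K t s) -> comb_ip K c w = comb_ip K w c.
Proof.
move=> Ksym; rewrite /comb_ip exchange_big; apply: eq_bigr => p _.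
by apply: eq_bigr => q _; rewrite Ksym (mulrC p.1).
Qed.

Lemma comb_sqnorm_cat K c w : (forall s t, K s t = K t s) ->
  comb_sqnorm K (c ++ w) = comb_sqnorm K c + 2 * comb_ip K c w + comb_sqnorm K w.
Proof.
move=> Ksym; rewrite -[LHS]/(comb_ip K _ _) comb_ip_catl !comb_ip_catr.
by rewrite (comb_ipC w c Ksym) /comb_ip /comb_sqnorm; ring.
Qed.

Lemma comb_sqnorm_scale K a c : comb_sqnorm K (comb_scale a c) = a ^+ 2 * comb_sqnorm K c.
Proof.
rewrite -[LHS]/(comb_ip K _ _) comb_ip_scalel comb_ip_scaler.
by rewrite mulrA -expr2.
Qed.

Lemma comb_eval_cat K c w s : comb_eval K (c ++ w) s = comb_eval K c s + comb_eval K w s.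
Proof. by rewrite /comb_eval big_cat. Qed.

Lemma comb_eval_scale K a c s : comb_eval K (comb_scale a c) s = a * comb_eval K c s.
Proof.
by rewrite /comb_eval big_map mulr_sumr; apply: eq_bigr => p _ /=; rewrite mulrA.
Qed.

Lemma eq_pos_def K L : (forall s t, K s t = L s t) -> pos_def K -> pos_def L.
Proof. by move=> KL; have -> : K = L by apply/funext => s; apply/funext => t. Qed.

Lemma pos_def_rank1M K (phi : S -> R) :
  pos_def K -> pos_def (fun s t => phi s * phi t * K s t).
Proof.
move=> K0 c; suff -> : comb_sqnorm (fun s t => phi s * phi t * K s t) c =
  comb_sqnorm K [seq (p.1 * phi p.2, p.2) | p <- c] by exact: K0.
rewrite /comb_sqnorm big_map; apply: eq_bigr => p _; rewrite big_map.
by apply: eq_bigr => q _ /=; ring.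
Qed.

Lemma pos_defD K L : pos_def K -> pos_def L -> pos_def (fun s t => K s t + L s t).
Proof.
move=> K0 L0 c; suff -> : comb_sqnorm (fun s t => K s t + L s t) c =
  comb_sqnorm K c + comb_sqnorm L c by exact: addr_ge0.
rewrite /comb_sqnorm -big_split; apply: eq_bigr => p _; rewrite -big_split.
by apply: eq_bigr => q _ /=; ring.
Qed.

Lemma cvg_big_sum (I J : Type) (F : set_system J) (FF : Filter F) (r : seq I)
    (f : I -> J -> R) (l : I -> R) :
  (forall i, f i x @[x --> F] --> l i) ->
  \sum_(i <- r) f i x @[x --> F] --> \sum_(i <- r) l i.
Proof.
move=> fl; elim: r => [|i r IH].
  rewrite big_nil; under eq_fun do rewrite big_nil; exact: cvg_cst.
rewrite big_cons; under eq_fun do rewrite big_cons; exact: cvgD.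
Qed.

Lemma pos_def_lim (Km : nat -> S -> S -> R) K :
  (forall m, pos_def (Km m)) ->
  (forall s t, Km m s t @[m --> \oo] --> K s t) -> pos_def K.
Proof.
move=> Km0 KmK c.
have cv : comb_sqnorm (Km m) c @[m --> \oo] --> comb_sqnorm K c.
  rewrite /comb_sqnorm; apply: cvg_big_sum => p; apply: cvg_big_sum => q.
  by apply: cvgM; [exact: cvg_cst|exact: KmK].
rewrite -(cvg_lim _ cv) //; apply: limr_ge; first by apply/cvg_ex; exists (comb_sqnorm K c).
by apply: nearW => m; exact: Km0.
Qed.

(** Each term of the exponential series is a rank-one kernel, so the partial sums times [K] stay
    positive definite and so does their limit. Carrying the factor [K] along lets exponentials be
    multiplied one after another without the general Schur product theorem. *)
Lemma pos_def_expM K (phi : S -> R) :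
  pos_def K -> pos_def (fun s t => expR (phi s * phi t) * K s t).
Proof.
move=> K0; apply: (@pos_def_lim
  (fun m s t => series (exp_coeff (phi s * phi t)) m * K s t)).
- elim=> [|m IH].
    apply: eq_pos_def (pos_def_rank1M (fun=> 0) K0) => s t.
    by rewrite /series /= big_geq // !mul0r.
  apply: eq_pos_def (pos_defD IH (pos_def_rank1M
    (fun s => phi s ^+ m * Num.sqrt (m`!%:R^-1)) K0)) => s t.
  rewrite /series /= big_nat_recr //= mulrDl; congr (_ + _ * _).
  by rewrite /exp_coeff /= exprMn mulrACA -expr2 sqr_sqrtr // invr_ge0.
- move=> s t; apply: cvgM; last exact: cvg_cst.
  exact: is_cvg_series_exp_coeff.
Qed.

Lemma pos_def_exp_sumM (I : Type) (r : seq I) (phi : I -> S -> R) K :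
  pos_def K -> pos_def (fun s t => expR (\sum_(i <- r) phi i s * phi i t) * K s t).
Proof.
move=> K0; elim: r => [|i r IH].
  by apply: eq_pos_def K0 => s t; rewrite big_nil expR0 mul1r.
apply: eq_pos_def (pos_def_expM (phi i) IH) => s t.
by rewrite big_cons expRD mulrA.
Qed.

Lemma comb_ip_le_norm K c w : (forall s t, K s t = K t s) -> pos_def K ->
  `|comb_ip K c w| <= Num.sqrt (comb_sqnorm K c) * Num.sqrt (comb_sqnorm K w).
Proof.
move=> Ksym K0; rewrite -sqrtr_sqr -sqrtrM // ler_wsqrtr //.
apply: discriminant_le => // t; have := K0 (c ++ comb_scale t w).
by rewrite comb_sqnorm_cat // comb_ip_scaler comb_sqnorm_scale mulrA.
Qed.

Lemma comb_norm_cat K c w : (forall s t, K s t = K t s) -> pos_def K ->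
  Num.sqrt (comb_sqnorm K (c ++ w)) <=
  Num.sqrt (comb_sqnorm K c) + Num.sqrt (comb_sqnorm K w).
Proof.
move=> Ksym K0; rewrite -(@ler_sqr _ (Num.sqrt _)) ?nnegrE ?addr_ge0 ?sqrtr_ge0 //.
rewrite sqrrD !sqr_sqrtr // comb_sqnorm_cat //.
have := le_trans (ler_norm _) (comb_ip_le_norm c w Ksym K0); lra.
Qed.

Lemma comb_norm_scale K a c :
  Num.sqrt (comb_sqnorm K (comb_scale a c)) = `|a| * Num.sqrt (comb_sqnorm K c).
Proof. by rewrite comb_sqnorm_scale sqrtrM ?sqr_ge0 // sqrtr_sqr. Qed.

End PositiveKernels.

(** * Gaussian kernels *)

Section GaussianKernel.
Variables (R : realType) (d : nat).
Implicit Types (sigma : R) (x y : d.-tuple R).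

Lemma sqdistC x y : sqdist x y = sqdist y x.
Proof. by apply: eq_bigr => i _; rewrite -sqrrN opprB. Qed.

Lemma sqdist_ge0 x y : 0 <= sqdist x y.
Proof. by apply: sumr_ge0 => i _; exact: sqr_ge0. Qed.

Lemma gauss_kernelC sigma x y : gauss_kernel sigma x y = gauss_kernel sigma y x.
Proof. by rewrite /gauss_kernel sqdistC. Qed.

Lemma gauss_kernel_ge0 sigma x y : 0 <= gauss_kernel sigma x y.
Proof. exact: expR_ge0. Qed.

Lemma gauss_kernel_le1 sigma x y : gauss_kernel sigma x y <= 1.
Proof.
rewrite /gauss_kernel expR_le1 mulNr oppr_le0 divr_ge0 ?sqdist_ge0 //.
by rewrite mulr_ge0 // sqr_ge0.
Qed.

Lemma gauss_kernelxx sigma x : gauss_kernel sigma x x = 1.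
Proof.
rewrite /gauss_kernel /sqdist big1 ?oppr0 ?mul0r ?expR0 // => i _.
by rewrite subrr expr0n.
Qed.

Lemma gauss_kernel_div_sqrt2 sigma x y :
  gauss_kernel (sigma / Num.sqrt 2) x y = gauss_kernel sigma x y * gauss_kernel sigma x y.
Proof.
rewrite /gauss_kernel -expRD; congr expR.
rewrite expr_div_n sqr_sqrtr // mulrCA divff // mulr1.
by rewrite (invfM 2); move: (sigma ^+ 2)^-1 => r; field.
Qed.

Lemma measurable_gauss_kernel sigma (dZ : measure_display) (Z : measurableType dZ)
    (f g : Z -> d.-tuple R) :
  measurable_fun setT f -> measurable_fun setT g ->
  measurable_fun setT (fun z => gauss_kernel sigma (f z) (g z)).
Proof.
move=> mf mg; apply: measurableT_comp => //.
apply: measurable_funM => //; apply: measurableT_comp => //.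
apply: measurable_sum => i; apply: measurable_funX; apply: measurable_funB.
- exact: (measurableT_comp (@measurable_tnth _ _ _ i) mf).
- exact: (measurableT_comp (@measurable_tnth _ _ _ i) mg).
Qed.

(** Expanding the square writes the Gaussian as e(x) e(y) exp(<x,y> / sigma^2): a rank-one factor
    times a product of exponentials, one per coordinate. The map [u] lets the Gaussian read one
    component of a pair, which gives the tensor kernel in two applications. *)
Lemma pos_def_gaussM sigma (S : Type) (u : S -> d.-tuple R) (K : S -> S -> R) :
  0 < sigma -> pos_def K -> pos_def (fun s t => gauss_kernel sigma (u s) (u t) * K s t).
Proof.
move=> s0 K0.
pose e s := expR (- (\sum_(i < d) tnth (u s) i ^+ 2) / (2 * sigma ^+ 2)).
apply: eq_pos_def (pos_def_rank1M e (pos_def_exp_sumM (index_enum 'I_d)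
  (fun i s => tnth (u s) i / sigma) K0)) => s t.
rewrite mulrA /e /gauss_kernel -!expRD; congr (expR _ * _).
rewrite /sqdist -!sumrN !mulr_suml -!big_split /=.
by apply: eq_bigr => i _; field; rewrite gt_eqF.
Qed.

Lemma pos_def_cst1 (S : Type) : pos_def (fun _ _ : S => 1 : R).
Proof.
move=> c; suff -> : comb_sqnorm (fun _ _ : S => 1) c = (\sum_(p <- c) p.1) ^+ 2.
  exact: sqr_ge0.
rewrite expr2 /comb_sqnorm mulr_suml; apply: eq_bigr => p _.
by rewrite mulr_sumr; apply: eq_bigr => q _; rewrite mulr1.
Qed.

Lemma pos_def_gauss sigma : 0 < sigma -> pos_def (@gauss_kernel R d sigma).
Proof.
move=> s0; apply: eq_pos_def (pos_def_gaussM id s0 (@pos_def_cst1 _)) => s t.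
by rewrite mulr1.
Qed.

Definition gauss_tensor sigma (p q : d.-tuple R * d.-tuple R) : R :=
  gauss_kernel sigma p.1 q.1 * gauss_kernel sigma p.2 q.2.

Lemma pos_def_gauss_tensor sigma : 0 < sigma -> pos_def (gauss_tensor sigma).
Proof.
move=> s0.
apply: eq_pos_def (pos_def_gaussM fst s0 (pos_def_gaussM snd s0 (@pos_def_cst1 _))) => s t.
by rewrite mulr1.
Qed.

End GaussianKernel.

(** * Scalar exponential inequalities for Hoeffding's lemma *)

Section Hoeffding.
Variable R : realType.

(** The quotient of the two sides is monotone: the derivative of its negative [F] is [D] times a
    positive factor, with D 0 = 0 and D' nonnegative on the half-line. The sharp exponent would be
    h^2 / 8. *)
Lemma bernoulli_mgf_le (p h : R) : 0 <= p <= 1 -> 0 <= h ->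
  1 - p + p * expR h <= expR (p * h + h ^+ 2 / 4).
Proof.
move=> /andP[p0 p1] h0.
pose D (x : R) : R := (p + x / 2) * (1 - p + p * expR x) - p * expR x.
pose D' (x : R) : R := 2^-1 * (1 - p + p * expR x) + (p + x / 2) * (p * expR x) - p * expR x.
have dD (x : R) : is_derive x 1 D (D' x).
  rewrite /D; apply: is_derive_eq; rewrite /D' /GRing.scale /=; ring.
have D'0 x : 0 <= x -> 0 <= D' x.
  move=> x0; have ex1 : 1 <= expR x by rewrite -expR0 ler_expR.
  have exx : expR x * (1 - x) <= 1.
    rewrite -ler_pdivlMl ?expR_gt0 // mulr1 -expRN; exact: expR_ge1Dx.
  have : p * (expR x * (1 - x)) <= p by rewrite ler_piMr.
  have : p ^+ 2 <= p ^+ 2 * expR x by rewrite ler_peMr // sqr_ge0.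
  (* The bounds above reduce D' x to at least 1/2 - p + p^2, which is half of (1 - p)^2 + p^2. *)
  have := sqr_ge0 (1 - p); have := sqr_ge0 p.
  rewrite /D'; nra.
have incr (f f' : R -> R) : (forall x : R, is_derive x 1 f (f' x)) ->
    (forall x, 0 <= x -> 0 <= f' x) -> forall x, 0 <= x -> f 0 <= f x.
  move=> df f'0 x x0.
  have [c cx e] := @MVT_segment R f f' 0 x x0 (fun y _ => df y)
    (derivable_within_continuous (fun y _ => @ex_derive _ _ _ _ _ _ _ (df y))).
  rewrite -subr_ge0 e mulr_ge0 ?subr0 // f'0 //.
  by move: cx; rewrite in_itv => /andP[].
have D0 x : 0 <= x -> 0 <= D x.
  move=> x0; have := incr D D' dD D'0 x x0; apply: le_trans.
  by rewrite /D expR0 mul0r addr0; lra.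
pose F (x : R) : R := - ((1 - p + p * expR x) * expR (- (p * x + x ^+ 2 / 4))).
pose F' (x : R) : R := D x * expR (- (p * x + x ^+ 2 / 4)).
have dF (x : R) : is_derive x 1 F (F' x).
  by rewrite /F; apply: is_derive_eq; rewrite /F' /D /GRing.scale /=; field.
have F'0 x : 0 <= x -> 0 <= F' x.
  by move=> x0; rewrite mulr_ge0 ?D0 ?expR_ge0.
have := incr F F' dF F'0 h h0.
rewrite /F lerN2 expRN ler_pdivrMr ?expR_gt0 //.
by rewrite expR0 mulr0 expr0n mul0r addr0 oppr0 expR0 !mulr1 subrK mul1r.
Qed.

(** Convexity through the tangent at t h: the tangent lies below exp at h and at 0, and weighting
    these two inequalities by t and 1 - t cancels the linear terms. *)
Lemma expR_chord (t h : R) : 0 <= t <= 1 -> expR (t * h) <= 1 - t + t * expR h.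
Proof.
move=> /andP[t0 t1]; set e := expR (t * h).
have e0 : 0 < e := expR_gt0 _.
have h1 : e * (1 + (1 - t) * h) <= expR h.
  rewrite (_ : expR h = e * expR ((1 - t) * h)); last by rewrite -expRD; congr expR; ring.
  by rewrite ler_pM2l //; exact: expR_ge1Dx.
have h2 : e * (1 - t * h) <= 1.
  by rewrite -ler_pdivlMl // mulr1 -expRN; exact: expR_ge1Dx.
have := ler_wpM2l t0 h1.
have : (1 - t) * (e * (1 - t * h)) <= 1 - t by rewrite ler_piMr // subr_ge0.
by move=> a b; nra.
Qed.

End Hoeffding.

(** * Expectations of bounded functions and Hoeffding's lemma *)

Section BoundedExpectation.
Variables (R : realType) (d : measure_display) (T : measurableType d).
Variable P : probability T R.
Implicit Types f g : T -> R.

(** This class is closed under all operations used below and integrable for every probability, so it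
    is the only side condition of the expectation lemmas. *)
Definition bounded_measurable f : Prop :=
  measurable_fun setT f /\ exists M : R, forall x, `|f x| <= M.

Lemma bounded_measurable_integrable f :
  bounded_measurable f -> P.-integrable setT (EFin \o f).
Proof.
move=> [mf [M fM]]; apply: measurable_bounded_integrable => //.
  by apply: (le_lt_trans (probability_le1 _ _)) => //; exact: ltry.
exists M; split; first exact: num_real.
by move=> y My x _; rewrite /= (le_trans (fM x)) // ltW.
Qed.

Lemma bounded_measurableD f g : bounded_measurable f -> bounded_measurable g ->
  bounded_measurable (fun x => f x + g x).
Proof.
move=> [mf [M fM]] [mg [N gN]]; split; first exact: measurable_funD.
by exists (M + N) => x; rewrite (le_trans (ler_normD _ _)) // lerD.
Qed.

Lemma bounded_measurable_cst (a : R) : bounded_measurable (fun=> a).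
Proof. by split; [exact: measurable_cst|exists `|a|]. Qed.

Lemma bounded_measurableM f g : bounded_measurable f -> bounded_measurable g ->
  bounded_measurable (fun x => f x * g x).
Proof.
move=> [mf [M fM]] [mg [N gN]]; split; first exact: measurable_funM.
by exists (M * N) => x; rewrite normrM ler_pM.
Qed.

Lemma bounded_measurable_expR f :
  bounded_measurable f -> bounded_measurable (fun x => expR (f x)).
Proof.
move=> [mf [M fM]]; split; first exact: measurableT_comp.
exists (expR M) => x; rewrite ger0_norm ?expR_ge0 // ler_expR.
exact: le_trans (ler_norm _) (fM x).
Qed.

Lemma bounded_measurable_sum (I : Type) (r : seq I) (f : I -> T -> R) :
  (forall i, bounded_measurable (f i)) ->
  bounded_measurable (fun x => \sum_(i <- r) f i x).
Proof.
move=> bf; elim: r => [|i r IH].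
  by under eq_fun do rewrite big_nil; exact: bounded_measurable_cst.
by under eq_fun do rewrite big_cons; exact: bounded_measurableD.
Qed.

Lemma expectation_cst (a : R) : \int[P]_x a = a.
Proof.
rewrite Rintegral_cst // -[RHS]mulr1; congr (_ * _).
exact: (congr1 fine (probability_setT P)).
Qed.

Lemma expectationD f g : bounded_measurable f -> bounded_measurable g ->
  \int[P]_x (f x + g x) = \int[P]_x f x + \int[P]_x g x.
Proof. by move=> bf bg; apply: RintegralD => //; exact: bounded_measurable_integrable. Qed.

Lemma expectationZ (a : R) f : bounded_measurable f ->
  \int[P]_x (a * f x) = a * \int[P]_x f x.
Proof. by move=> bf; apply: RintegralZl => //; exact: bounded_measurable_integrable. Qed.

Lemma expectation_sum (I : Type) (r : seq I) (f : I -> T -> R) :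
  (forall i, bounded_measurable (f i)) ->
  \int[P]_x (\sum_(i <- r) f i x) = \sum_(i <- r) \int[P]_x f i x.
Proof.
move=> bf; elim: r => [|i r IH].
  rewrite big_nil; under eq_fun do rewrite big_nil; exact: expectation_cst.
rewrite big_cons -IH; under eq_fun do rewrite big_cons.
by rewrite expectationD //; exact: bounded_measurable_sum.
Qed.

Lemma le_expectation f g : bounded_measurable f -> bounded_measurable g ->
  (forall x, f x <= g x) -> \int[P]_x f x <= \int[P]_x g x.
Proof.
by move=> bf bg fg; apply: le_Rintegral => //; exact: bounded_measurable_integrable.
Qed.

Lemma expectation_sqr_le f : bounded_measurable f ->
  (\int[P]_x f x) ^+ 2 <= \int[P]_x (f x ^+ 2).
Proof.
move=> bf; set e := \int[P]_x f x.
have bf2 : bounded_measurable (fun x => f x ^+ 2).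
  by under eq_fun do rewrite expr2; exact: bounded_measurableM.
have b2 : bounded_measurable (fun x => - (2 * e) * f x).
  by apply: bounded_measurableM => //; exact: bounded_measurable_cst.
have : 0 <= \int[P]_x (f x ^+ 2 + (- (2 * e) * f x + e ^+ 2)).
  by apply: Rintegral_ge0 => x _; rewrite (_ : _ + _ = (f x - e) ^+ 2) ?sqr_ge0 //; ring.
rewrite expectationD //; last first.
  by apply: bounded_measurableD => //; exact: bounded_measurable_cst.
rewrite expectationD //; last exact: bounded_measurable_cst.
rewrite expectation_cst expectationZ // -/e; move: (\int[P]_x _) => I; nra.
Qed.

(** Only the oscillation of [f] is bounded. After rescaling [f] to [0,1] from its infimum, the chord
    inequality dominates the exponential by an affine function of [f], whose expectation is the
    moment generating function of a Bernoulli variable of mean [p]. *)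
Lemma hoeffding_mgf_le f (c l : R) : bounded_measurable f -> 0 < c -> 0 <= l ->
  (forall x y, f x - f y <= c) ->
  \int[P]_x expR (l * f x) <= expR (l * \int[P]_x f x + l ^+ 2 * c ^+ 2 / 4).
Proof.
move=> bf c0 l0 fc; pose m := inf (range f).
(* Total mass 1 excludes an empty [T]; the infimum of the range is a greatest lower bound only when
   the range is nonempty. *)
have [x0 _] : [set: T] !=set0.
  apply/set0P/negP => /eqP T0; have := probability_setT P.
  by rewrite T0 measure0 => /eqP; rewrite eq_sym onee_eq0.
have [_ [M fM]] := bf.
have mf x : m <= f x.
  apply: ge_inf; last by exists x.
  by exists (- M) => _ [y _ <-]; have := fM y; rewrite ler_norml => /andP[].
have fmc x : f x - m <= c.
  rewrite lerBlDl -lerBlDr; apply: lb_le_inf; first by exists (f x0), x0.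
  by move=> _ [y _ <-]; rewrite lerBlDr -lerBlDl fc.
pose p := (\int[P]_x f x - m) / c.
have bm : bounded_measurable (fun x => (f x - m) / c).
  apply: bounded_measurableM; last exact: bounded_measurable_cst.
  by apply: bounded_measurableD => //; exact: bounded_measurable_cst.
have pE : \int[P]_x ((f x - m) / c) = p.
  under eq_fun do rewrite mulrC.
  rewrite expectationZ; last by apply: bounded_measurableD => //; exact: bounded_measurable_cst.
  rewrite expectationD //; last exact: bounded_measurable_cst.
  by rewrite expectation_cst mulrC.
have tx x : 0 <= (f x - m) / c <= 1.
  by rewrite divr_ge0 ?subr_ge0 ?(ltW c0) //= ler_pdivrMr // mul1r.
have p01 : 0 <= p <= 1.
  rewrite -pE; apply/andP; split.
    by apply: Rintegral_ge0 => x _; case/andP: (tx x).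
  rewrite -[leRHS]expectation_cst; apply: le_expectation => //.
    exact: bounded_measurable_cst.
  by move=> x; case/andP: (tx x).
have step : \int[P]_x expR (l * f x) <=
    \int[P]_x (expR (l * m) * (1 + (expR (l * c) - 1) * ((f x - m) / c))).
  apply: le_expectation.
  - by apply: bounded_measurable_expR; apply: bounded_measurableM => //; exact: bounded_measurable_cst.
  - apply: bounded_measurableM; first exact: bounded_measurable_cst.
    apply: bounded_measurableD; first exact: bounded_measurable_cst.
    by apply: bounded_measurableM => //; exact: bounded_measurable_cst.
  - move=> x; have -> : l * f x = l * m + (f x - m) / c * (l * c) by field; rewrite gt_eqF.
    rewrite expRD ler_pM2l ?expR_gt0 //; apply: (le_trans (expR_chord _ (tx x))).
    by rewrite le_eqVlt; apply/orP; left; apply/eqP; ring.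
apply: (le_trans step).
rewrite expectationZ; last first.
  apply: bounded_measurableD; first exact: bounded_measurable_cst.
  by apply: bounded_measurableM => //; exact: bounded_measurable_cst.
rewrite expectationD; [|exact: bounded_measurable_cst|]; last first.
  by apply: bounded_measurableM => //; exact: bounded_measurable_cst.
rewrite expectation_cst expectationZ // pE.
have -> : l * \int[P]_x f x + l ^+ 2 * c ^+ 2 / 4 = l * m + (p * (l * c) + (l * c) ^+ 2 / 4).
  by rewrite /p; field; rewrite gt_eqF.
rewrite [leRHS]expRD ler_pM2l ?expR_gt0 //.
apply: le_trans (bernoulli_mgf_le p01 (mulr_ge0 l0 (ltW c0))).
by rewrite le_eqVlt; apply/orP; left; apply/eqP; ring.
Qed.

End BoundedExpectation.

(** * Mean embeddings and sample averages *)

Section MeanEmbedding.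
Variables (R : realType) (d : measure_display) (T : measurableType d).
Variable P : probability T R.

Lemma measurable_expectation_param (dZ : measure_display) (Z : measurableType dZ)
    (F : Z * T -> R) :
  measurable_fun setT F -> (forall z, 0 <= F z) ->
  measurable_fun setT (fun z => \int[P]_y F (z, y)).
Proof.
move=> mF F0.
have mI : measurable_fun setT (fubini_F P (EFin \o F)).
  apply: measurable_fun_fubini_tonelli_F; first exact/measurable_EFinP.
  by move=> x; rewrite lee_fin.
 exact: (measurableT_comp (@fine_measurable R setT measurableT) mI).
Qed.

(** Samples live in [T] and the kernel on [S]: the application takes pairs for [S] and the diagonal
    map for [iota]. Measurability comes in two forms because the centres of a combination need not
    lie in the image of [iota], while those of the sample vector do and vary with the sample. *)
Record unit_kernel (S : Type) (K : S -> S -> R) (iota : T -> S) : Prop := UnitKernel {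
  unit_kernelC : forall s t, K s t = K t s ;
  unit_kernel_pos : pos_def K ;
  unit_kernelxx : forall s, K s s = 1 ;
  unit_kernel_ge0 : forall s t, 0 <= K s t ;
  unit_kernel_le1 : forall s t, K s t <= 1 ;
  unit_kernel_measurable1 : forall s, measurable_fun setT (fun y => K s (iota y)) ;
  unit_kernel_measurable2 : forall (dZ : measure_display) (Z : measurableType dZ)
    (f g : Z -> T), measurable_fun setT f -> measurable_fun setT g ->
    measurable_fun setT (fun z => K (iota (f z)) (iota (g z))) }.

Variables (S : Type) (K : S -> S -> R) (iota : T -> S).
Hypothesis HK : unit_kernel K iota.
Let Ksym : forall s t, K s t = K t s. Proof. by case: HK. Qed.
Let Kpos : pos_def K. Proof. by case: HK. Qed.
Let Kdiag : forall s, K s s = 1. Proof. by case: HK. Qed.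
Let Kge0 : forall s t, 0 <= K s t. Proof. by case: HK. Qed.
Let Kle1 : forall s t, K s t <= 1. Proof. by case: HK. Qed.
Let Kmeas1 : forall s, measurable_fun setT (fun y => K s (iota y)).
Proof. by case: HK. Qed.
Let Kmeas2 : forall (dZ : measure_display) (Z : measurableType dZ)
  (f g : Z -> T), measurable_fun setT f -> measurable_fun setT g ->
  measurable_fun setT (fun z => K (iota (f z)) (iota (g z))).
Proof. by case: HK. Qed.
Implicit Types (c w : seq (R * S)) (u v : seq (R * S) * R).

Definition mean_emb (s : S) : R := \int[P]_y K s (iota y).

Definition mean_emb_sqnorm : R := \int[P]_y mean_emb (iota y).
Local Notation kappa := mean_emb_sqnorm.

Lemma bounded_measurable_kernel s : bounded_measurable (fun y => K s (iota y)).
Proof. by split => //; exists 1 => y; rewrite ger0_norm. Qed.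

Lemma mean_emb_ge0 s : 0 <= mean_emb s.
Proof. by apply: Rintegral_ge0 => y _. Qed.

Lemma mean_emb_le1 s : mean_emb s <= 1.
Proof.
rewrite /mean_emb -[leRHS](expectation_cst P); apply: le_expectation => //.
- exact: bounded_measurable_kernel.
- exact: bounded_measurable_cst.
Qed.

Lemma measurable_mean_emb (dZ : measure_display) (Z : measurableType dZ) (f : Z -> T) :
  measurable_fun setT f -> measurable_fun setT (fun z => mean_emb (iota (f z))).
Proof.
move=> mf; apply: (@measurable_expectation_param _ _ (fun z => K (iota (f z.1)) (iota z.2))).
  by apply: Kmeas2 => //; exact: measurableT_comp.
by move=> z.
Qed.

Lemma bounded_measurable_mean_emb : bounded_measurable (fun y => mean_emb (iota y)).
Proof.
split; first exact: (measurable_mean_emb (@measurable_id _ _ setT)).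
by exists 1 => y; rewrite ger0_norm ?mean_emb_ge0 ?mean_emb_le1.
Qed.

Lemma mean_emb_sqnorm_ge0 : 0 <= kappa.
Proof. by apply: Rintegral_ge0 => y _; exact: mean_emb_ge0. Qed.

Lemma mean_emb_sqnorm_le1 : kappa <= 1.
Proof.
rewrite /mean_emb_sqnorm -[leRHS](expectation_cst P); apply: le_expectation => //.
- exact: bounded_measurable_mean_emb.
- exact: bounded_measurable_cst.
- by move=> x; exact: mean_emb_le1.
Qed.

(** This is the inner product of [w] with mu_P; [expectation_comb_eval] identifies it with the
    expectation of the function that [w] represents. *)
Definition comb_mean w : R := \sum_(p <- w) p.1 * mean_emb p.2.

Lemma bounded_measurable_comb_eval w :
  bounded_measurable (fun y => comb_eval K w (iota y)).
Proof.
apply: bounded_measurable_sum => p; apply: bounded_measurableM.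
  exact: bounded_measurable_cst.
exact: bounded_measurable_kernel.
Qed.

Lemma expectation_comb_eval w : \int[P]_y comb_eval K w (iota y) = comb_mean w.
Proof.
rewrite /comb_eval expectation_sum; last first.
  move=> p; apply: bounded_measurableM; first exact: bounded_measurable_cst.
  exact: bounded_measurable_kernel.
by apply: eq_bigr => p _; rewrite expectationZ //; exact: bounded_measurable_kernel.
Qed.

Lemma comb_ip_dirac a s w : comb_ip K [:: (a, s)] w = a * comb_eval K w s.
Proof.
rewrite /comb_ip /comb_eval big_seq1 mulr_sumr; apply: eq_bigr => q _ /=.
by rewrite mulrA Ksym.
Qed.

Lemma comb_sqnorm_dirac a s : comb_sqnorm K [:: (a, s)] = a ^+ 2.
Proof. by rewrite /comb_sqnorm !big_seq1 Kdiag mulr1 expr2. Qed.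

Lemma comb_mean_cat w w' : comb_mean (w ++ w') = comb_mean w + comb_mean w'.
Proof. by rewrite /comb_mean big_cat. Qed.

Lemma comb_mean_scale a w : comb_mean (comb_scale a w) = a * comb_mean w.
Proof.
by rewrite /comb_mean big_map mulr_sumr; apply: eq_bigr => p _; rewrite mulrA.
Qed.

Lemma comb_mean_dirac a s : comb_mean [:: (a, s)] = a * mean_emb s.
Proof. by rewrite /comb_mean big_seq1. Qed.

(* The left-hand side is the expected squared norm of [w] plus [a] times the
   feature vectors of [N] independent samples; the induction peels off one sample. *)
Lemma comb_sqnorm_sample_ge0 (N : nat) (a : R) w :
  0 <= comb_sqnorm K w + 2 * a * N%:R * comb_mean w
       + a ^+ 2 * (N%:R + N%:R * (N%:R - 1) * kappa).
Proof.
elim: N w => [|N IH] w.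
  by rewrite !mulr0 !mul0r !addr0 mulr0 addr0; exact: Kpos.
pose A := comb_sqnorm K w + 2 * a * N%:R * comb_mean w + a ^+ 2
       + a ^+ 2 * (N%:R + N%:R * (N%:R - 1) * kappa).
have h y : 0 <= A + (2 * a * comb_eval K w (iota y)
    + 2 * a ^+ 2 * N%:R * mean_emb (iota y)).
  have := IH ([:: (a, iota y)] ++ w); rewrite (comb_sqnorm_cat _ _ Ksym).
  rewrite comb_sqnorm_dirac comb_ip_dirac comb_mean_cat comb_mean_dirac /A => /le_trans; apply.
  by rewrite le_eqVlt; apply/orP; left; apply/eqP; ring.
have : 0 <= \int[P]_y (A + (2 * a * comb_eval K w (iota y)
    + 2 * a ^+ 2 * N%:R * mean_emb (iota y))).
  by apply: Rintegral_ge0 => y _; exact: h.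
have b1 : bounded_measurable (fun y => 2 * a * comb_eval K w (iota y)).
  apply: bounded_measurableM; first exact: bounded_measurable_cst.
  exact: bounded_measurable_comb_eval.
have b2 : bounded_measurable (fun y => 2 * a ^+ 2 * N%:R * mean_emb (iota y)).
  apply: bounded_measurableM; first exact: bounded_measurable_cst.
  exact: bounded_measurable_mean_emb.
rewrite expectationD; [|exact: bounded_measurable_cst|exact: bounded_measurableD].
rewrite expectation_cst expectationD // expectationZ; last exact: bounded_measurable_comb_eval.
rewrite expectationZ; last exact: bounded_measurable_mean_emb.
rewrite expectation_comb_eval -/kappa /A => /le_trans; apply.
by rewrite le_eqVlt; apply/orP; left; apply/eqP; rewrite -natr1; ring.
Qed.

(* A pair [(w, a)] stands for [w + a * mu_P], with [mu_P] the mean embedding of [P]. *)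
Definition ext_ip u v : R :=
  comb_ip K u.1 v.1 + u.2 * comb_mean v.1 + v.2 * comb_mean u.1 + u.2 * v.2 * kappa.

Definition ext_norm v : R := Num.sqrt (ext_ip v v).

Definition ext_add u v : seq (R * S) * R := (u.1 ++ v.1, u.2 + v.2).

Definition ext_scale (a : R) v : seq (R * S) * R := (comb_scale a v.1, a * v.2).

(** The vector mu_P need not be a finite combination, so positivity is not inherited directly from
    [K]. Replacing a mu_P by a/N times the sum of N random feature vectors gives a nonnegative
    expected squared norm, which exceeds the wanted quantity by exactly a^2 (1 - kappa) / N; N then
    tends to infinity. *)
Lemma ext_ip_ge0 v : 0 <= ext_ip v v.
Proof.
case: v => w a; rewrite /ext_ip /=; set e := (X in 0 <= X).
pose b := a ^+ 2 * (1 - kappa).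
have b0 : 0 <= b by rewrite mulr_ge0 ?sqr_ge0 // subr_ge0 mean_emb_sqnorm_le1.
have h (N : nat) : 0 <= e + b / N.+1%:R.
  have := comb_sqnorm_sample_ge0 N.+1 (a / N.+1%:R) w => /le_trans; apply.
  rewrite le_eqVlt; apply/orP; left; apply/eqP; rewrite /e /b -[comb_ip K w w]/(comb_sqnorm K w).
  by field; rewrite addrC natr1 pnatr_eq0.
rewrite leNgt; apply/negP => e0.
have := h (Num.truncn (b / - e)); apply/negP; rewrite -ltNge.
rewrite addrC -ltrBrDr sub0r ltr_pdivrMr ?ltr0n // mulrC -ltr_pdivrMr ?oppr_gt0 //.
exact: truncnS_gt.
Qed.

Lemma ext_ipC u v : ext_ip u v = ext_ip v u.
Proof. by rewrite /ext_ip (comb_ipC _ _ Ksym); ring. Qed.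

Lemma ext_ip_addl u u' v : ext_ip (ext_add u u') v = ext_ip u v + ext_ip u' v.
Proof. by rewrite /ext_ip /= comb_ip_catl comb_mean_cat; ring. Qed.

Lemma ext_ip_scalel a u v : ext_ip (ext_scale a u) v = a * ext_ip u v.
Proof. by rewrite /ext_ip /= comb_ip_scalel comb_mean_scale; ring. Qed.

Lemma ext_ip_le_norm u v : `|ext_ip u v| <= ext_norm u * ext_norm v.
Proof.
have h : ext_ip u v ^+ 2 <= ext_ip u u * ext_ip v v.
  apply: discriminant_le; try exact: ext_ip_ge0.
  move=> t; have := ext_ip_ge0 (ext_add u (ext_scale t v)).
  rewrite ext_ip_addl ext_ip_scalel ext_ipC ext_ip_addl ext_ip_scalel.
  rewrite (ext_ipC v (ext_add _ _)) ext_ip_addl ext_ip_scalel (ext_ipC v u).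
  move=> /le_trans; apply.
  by rewrite le_eqVlt; apply/orP; left; apply/eqP; ring.
by rewrite -sqrtr_sqr /ext_norm -sqrtrM ?ext_ip_ge0 // ler_wsqrtr.
Qed.

Lemma ext_norm_ge0 v : 0 <= ext_norm v.
Proof. exact: sqrtr_ge0. Qed.

Lemma ext_norm_sqr v : ext_norm v ^+ 2 = ext_ip v v.
Proof. by rewrite sqr_sqrtr // ext_ip_ge0. Qed.

(* Different lists can represent the same vector, hence the hypothesis in place of an equation. *)
Lemma ext_norm_triangle u v v' :
  (forall z, ext_ip u z = ext_ip v z + ext_ip v' z) ->
  ext_norm u <= ext_norm v + ext_norm v'.
Proof.
move=> uE; rewrite -(@ler_sqr _ (ext_norm u)) ?nnegrE ?addr_ge0 ?ext_norm_ge0 //.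
rewrite ext_norm_sqr uE ext_ipC uE (ext_ipC v' u) uE.
have := le_trans (ler_norm _) (ext_ip_le_norm v v').
rewrite (ext_ipC v' v) sqrrD !ext_norm_sqr; lra.
Qed.

(** The sum of the centred features is not divided by the sample size, so that adding a sample adds
    one summand and leaves the others unchanged. *)
Definition sample_vec (xs : seq T) : seq (R * S) * R :=
  ([seq (1, iota x) | x <- xs], - (size xs)%:R).

Definition sample_norm (xs : seq T) : R := ext_norm (sample_vec xs).

Lemma comb_ip_consl p c w : comb_ip K (p :: c) w = comb_ip K [:: p] w + comb_ip K c w.
Proof. by rewrite -cat1s comb_ip_catl. Qed.

Lemma comb_mean_cons p w : comb_mean (p :: w) = comb_mean [:: p] + comb_mean w.
Proof. by rewrite -cat1s comb_mean_cat. Qed.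

Lemma sample_norm_pairing w xs :
  `|\sum_(x <- xs) comb_eval K w (iota x) - (size xs)%:R * comb_mean w|
    <= Num.sqrt (comb_sqnorm K w) * sample_norm xs.
Proof.
have := ext_ip_le_norm (w, 0) (sample_vec xs).
rewrite {1}/ext_norm /ext_ip /= !mul0r !addr0 mulNr.
suff -> : comb_ip K w [seq (1, iota x) | x <- xs] = \sum_(x <- xs) comb_eval K w (iota x) by [].
rewrite (comb_ipC _ _ Ksym) /comb_ip big_map; apply: eq_bigr => x _.
by rewrite /comb_eval; apply: eq_bigr => q _ /=; rewrite mul1r Ksym.
Qed.

(** The two vectors differ by a difference of two unit features, of squared norm 2 - 2 K(y,y').
    Nonnegativity of [K] makes this at most 2, so the constant is sqrt 2 rather than 2. *)
Lemma sample_norm_swap (s : seq T) y y' xs :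
  sample_norm (s ++ y :: xs) <= sample_norm (s ++ y' :: xs) + Num.sqrt 2.
Proof.
pose v : seq (R * S) * R := ([:: (1, iota y); (-1, iota y')], 0).
have nv : ext_norm v <= Num.sqrt 2.
  rewrite ler_wsqrtr // /ext_ip /v /= !mul0r !addr0 comb_ip_consl !comb_ip_dirac.
  rewrite /comb_eval !big_cons !big_nil /= !Kdiag (Ksym (iota y')).
  have := Kge0 (iota y) (iota y'); lra.
apply: le_trans (lerD (lexx _) nv); apply: ext_norm_triangle => z.
rewrite /ext_ip /sample_vec /v !size_cat /= !map_cat /= !comb_ip_catl.
rewrite !(comb_ip_consl _ (_ :: _)) !(comb_ip_consl _ (map _ _)) !comb_mean_cat.
rewrite !(comb_mean_cons _ (_ :: _)) !(comb_mean_cons _ (map _ _)).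
by rewrite !comb_ip_dirac !comb_mean_dirac; ring.
Qed.

(** A crude bound, which serves to bound [sample_norm] in terms of the length of the list, as
    admissibility requires. *)
Lemma sample_norm_cons y xs : sample_norm (y :: xs) <= sample_norm xs + 2.
Proof.
pose v : seq (R * S) * R := ([:: (1, iota y)], -1).
have nv : ext_norm v <= 2.
  have -> : 2 = Num.sqrt (2 ^+ 2) :> R by rewrite sqrtr_sqr ger0_norm.
  rewrite ler_wsqrtr //.
  rewrite /ext_ip /v /= comb_ip_dirac comb_mean_dirac /comb_eval big_seq1 /= Kdiag.
  have := mean_emb_ge0 (iota y); have := mean_emb_sqnorm_le1; lra.
apply: le_trans (lerD (lexx _) nv); apply: ext_norm_triangle => z.
rewrite /ext_ip /sample_vec /v /= comb_ip_consl comb_mean_cons -natr1.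
by ring.
Qed.

Lemma sample_norm_nil : sample_norm [::] = 0.
Proof.
rewrite /sample_norm /ext_norm /ext_ip /= oppr0 !mul0r !addr0.
by rewrite /comb_ip big_nil sqrtr0.
Qed.

Lemma sample_norm_le xs : sample_norm xs <= 2 * (size xs)%:R.
Proof.
elim: xs => [|y xs IH]; first by rewrite sample_norm_nil mulr0.
by apply: (le_trans (sample_norm_cons _ _)); rewrite /= -[(size xs).+1%:R]natr1 mulrDr mulr1 lerD2r.
Qed.

(** The new summand is centred, so the cross term integrates to 0, and its own expected squared norm
    is 1 - kappa. *)
Lemma expectation_sample_norm_sqr xs :
  \int[P]_y (sample_norm (y :: xs) ^+ 2) <= sample_norm xs ^+ 2 + 1.
Proof.
pose w : seq (R * S) := [seq (1, iota x) | x <- xs]; pose n : R := (size xs)%:R.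
have e y : sample_norm (y :: xs) ^+ 2 =
   (1 + comb_sqnorm K w - 2 * (n + 1) * comb_mean w + (n + 1) ^+ 2 * kappa)
   + (2 * comb_eval K w (iota y) + - (2 * (n + 1)) * mean_emb (iota y)).
  rewrite ext_norm_sqr /ext_ip /= -/w -natr1 -/n -[comb_ip K _ _]/(comb_sqnorm K ([:: _] ++ w)).
  rewrite (comb_sqnorm_cat _ _ Ksym) comb_sqnorm_dirac comb_ip_dirac comb_mean_cons.
  by rewrite comb_mean_dirac; ring.
under eq_fun do rewrite e.
have b1 : bounded_measurable (fun y => 2 * comb_eval K w (iota y)).
  apply: bounded_measurableM; first exact: bounded_measurable_cst.
  exact: bounded_measurable_comb_eval.
have b2 : bounded_measurable (fun y => - (2 * (n + 1)) * mean_emb (iota y)).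
  apply: bounded_measurableM; first exact: bounded_measurable_cst.
  exact: bounded_measurable_mean_emb.
rewrite expectationD; [|exact: bounded_measurable_cst|exact: bounded_measurableD].
rewrite expectation_cst expectationD // expectationZ; last exact: bounded_measurable_comb_eval.
rewrite expectationZ; last exact: bounded_measurable_mean_emb.
rewrite expectation_comb_eval -/kappa ext_norm_sqr /ext_ip /= -/w -/n.
have := mean_emb_sqnorm_ge0; rewrite -[comb_ip K w w]/(comb_sqnorm K w).
by move: (comb_sqnorm K w) (comb_mean w) => A B; nra.
Qed.

(** Conditional expectation given the tail: [iter m average F xs] averages [F] over m fresh samples
    placed in front of the fixed [xs]. Successive iterates form the martingale. *)
Definition average (F : seq T -> R) (xs : seq T) : R := \int[P]_y F (y :: xs).

(* Joint measurability is tested on samples driven by an arbitrary measurable space,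
   so that it is stable under integrating out the head of the list. *)
Definition admissible (F : seq T -> R) : Prop :=
  [/\ forall xs, 0 <= F xs,
      exists b : nat -> R, forall xs, F xs <= b (size xs) &
      forall (dZ : measure_display) (Z : measurableType dZ) (f : nat -> Z -> T) (m : nat),
        (forall i, (i < m)%N -> measurable_fun setT (f i)) ->
        measurable_fun setT (fun z => F (mkseq (f ^~ z) m))].

Lemma admissible_bounded_measurable F xs :
  admissible F -> bounded_measurable (fun y => F (y :: xs)).
Proof.
move=> [F0 [b Fb] mF]; split; last first.
  by exists (b (size xs).+1) => y; rewrite ger0_norm.
have -> : (fun y => F (y :: xs)) = (fun y => F (mkseq (fun i => nth y (y :: xs) i) (size xs).+1)).
  by apply/funext => y; rewrite (mkseq_nth y (y :: xs)).
apply: (mF _ _ (fun i y => nth y (y :: xs) i)) => -[_|i] /=; first exact: measurable_id.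
rewrite ltnS => ixs.
(* The default of [nth] varies with [y] and hides that the entry is constant; a fixed default exists
   because [xs] has an entry here. *)
have [x0|] := pselect (inhabited T); last by move=> h; case: xs ixs h => // x xs _ []; exists.
case: x0 => x0; under eq_fun do rewrite (set_nth_default x0) //.
exact: measurable_cst.
Qed.

Lemma admissible_average F : admissible F -> admissible (average F).
Proof.
move=> aF; have [F0 [b Fb] mF] := aF; split.
- by move=> xs; apply: Rintegral_ge0 => y _.
- exists (fun m => b m.+1) => xs; rewrite -[leRHS](expectation_cst P).
  apply: le_expectation; first exact: admissible_bounded_measurable.
    exact: bounded_measurable_cst.
  by move=> y; exact: Fb.
- move=> dZ Z f m mf.
  pose g i (z : Z * T) := if i is j.+1 then f j z.1 else z.2.
  have gE z y : y :: mkseq (f ^~ z) m = mkseq (g ^~ (z, y)) m.+1.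
    by rewrite /mkseq /= -[1%N]addn0 iotaDl -map_comp.
  have -> : (fun z => average F (mkseq (f ^~ z) m)) =
      (fun z => \int[P]_y (fun zy => F (mkseq (g ^~ zy) m.+1)) (z, y)).
    apply/funext => z; rewrite /average; congr (Rintegral _ _ _).
    by apply/funext => y; rewrite gE.
  apply: (@measurable_expectation_param _ _ (fun zy => F (mkseq (g ^~ zy) m.+1))) => //.
  apply: mF => -[_|i] /=.
    exact: measurable_snd.
  by rewrite ltnS => im; apply: measurableT_comp => //; exact: mf.
Qed.

Lemma admissible_iter_average m F : admissible F -> admissible (iter m average F).
Proof. by move=> aF; elim: m => //= m IH; exact: admissible_average. Qed.

Lemma admissible_sample_norm : admissible sample_norm.
Proof.
split; first by move=> xs; exact: ext_norm_ge0.
  by exists (fun m => 2 * m%:R) => xs; exact: sample_norm_le.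
move=> dZ Z f m mf; rewrite /sample_norm /ext_norm.
apply: measurableT_comp.
  by apply: continuous_measurable_fun; exact: sqrt_continuous.
have mL : measurable_fun setT (fun z =>
    comb_mean [seq (1, iota x) | x <- mkseq (f ^~ z) m]).
  rewrite /comb_mean; under eq_fun do rewrite !big_map -{1}(subn0 m) big_mkord.
  apply: measurable_sum => i; apply: measurable_funM => //=.
  by apply: measurable_mean_emb; exact: mf.
rewrite /ext_ip /=; under eq_fun do rewrite size_mkseq.
apply: measurable_funD; last by [].
apply: measurable_funD; last exact: measurable_funM.
apply: measurable_funD; last exact: measurable_funM.
rewrite /comb_ip; under eq_fun do rewrite !big_map -{1}(subn0 m) big_mkord.
apply: measurable_sum => i; under eq_fun do rewrite !big_map -{1}(subn0 m) big_mkord.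
apply: measurable_sum => j; apply: measurable_funM => //=.
by apply: Kmeas2; exact: mf.
Qed.

Lemma admissible_expR (l : R) F : 0 <= l -> admissible F ->
  admissible (fun xs => expR (l * F xs)).
Proof.
move=> l0 [F0 [b Fb] mF]; split; first by move=> xs; exact: expR_ge0.
  by exists (fun m => expR (l * b m)) => xs; rewrite ler_expR ler_wpM2l.
move=> dZ Z f m mf; apply: measurableT_comp => //.
by apply: measurable_funM => //; exact: mF.
Qed.

(** The swap bound holds for every value of the samples being integrated, hence survives averaging.
    The prefix [s] is generalised because each averaging puts a new sample in front. *)
Lemma average_sample_norm_swap m (s : seq T) y y' xs :
  iter m average sample_norm (s ++ y :: xs)
    <= iter m average sample_norm (s ++ y' :: xs) + Num.sqrt 2.
Proof.
elim: m s => [|m IH] s; first exact: sample_norm_swap.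
have aN := admissible_iter_average m admissible_sample_norm.
rewrite /= {1 2}/average -[X in _ + X](expectation_cst P) -expectationD; last first.
- exact: bounded_measurable_cst.
- exact: admissible_bounded_measurable.
apply: le_expectation; first exact: admissible_bounded_measurable.
  apply: bounded_measurableD; first exact: admissible_bounded_measurable.
  exact: bounded_measurable_cst.
by move=> z; exact: (IH (z :: s)).
Qed.

Lemma bounded_measurable_sqr (f : T -> R) :
  bounded_measurable f -> bounded_measurable (fun y => f y ^+ 2).
Proof. by move=> bf; under eq_fun do rewrite expr2; exact: bounded_measurableM. Qed.

(** Jensen's inequality moves the square inside each average, and each fresh sample then contributes
    at most 1. From the empty list this bounds the mean norm of m samples by sqrt m. *)
Lemma average_sample_norm_sqr m xs :
  iter m average sample_norm xs ^+ 2 <= sample_norm xs ^+ 2 + m%:R.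
Proof.
elim: m xs => [|m IH] xs; first by rewrite addr0.
have bN k ys := admissible_bounded_measurable ys
  (admissible_iter_average k admissible_sample_norm).
rewrite /=; apply: (le_trans (expectation_sqr_le P (bN m xs))).
rewrite -natr1 (addrC m%:R) addrA.
apply: le_trans (lerD (expectation_sample_norm_sqr xs) (lexx m%:R)).
rewrite -[X in _ + X](expectation_cst P) -expectationD; last first.
- exact: bounded_measurable_cst.
- exact/bounded_measurable_sqr/(bN 0%N).
apply: le_expectation => //; first exact/bounded_measurable_sqr/bN.
apply: bounded_measurableD; last exact: bounded_measurable_cst.
exact/bounded_measurable_sqr/(bN 0%N).
Qed.

Lemma average_sample_norm_le (m : nat) :
  iter m average sample_norm [::] <= Num.sqrt m%:R.
Proof.
apply: (le_trans (ler_norm _)); rewrite -sqrtr_sqr ler_wsqrtr //.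
by have := average_sample_norm_sqr m [::]; rewrite sample_norm_nil expr0n add0r.
Qed.

(* Azuma's argument: each sample moves the conditional mean by at most [sqrt 2]. *)
Lemma average_expR_sample_norm_le m (l : R) xs : 0 <= l ->
  iter m average (fun xs => expR (l * sample_norm xs)) xs
    <= expR (l * iter m average sample_norm xs + m%:R * (l ^+ 2 / 2)).
Proof.
move=> l0; elim: m xs => [|m IH] xs; first by rewrite mul0r addr0.
have bN := admissible_bounded_measurable xs
  (admissible_iter_average m admissible_sample_norm).
have bE : bounded_measurable (fun y => expR (l * iter m average sample_norm (y :: xs))).
  apply: bounded_measurable_expR; apply: bounded_measurableM => //.
  exact: bounded_measurable_cst.
rewrite /= {1}/average.
apply: (@le_trans _ _ (\int[P]_y (expR (m%:R * (l ^+ 2 / 2)) *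
    expR (l * iter m average sample_norm (y :: xs))))).
  apply: le_expectation.
  - apply: admissible_bounded_measurable; apply: admissible_iter_average.
    by apply: admissible_expR => //; exact: admissible_sample_norm.
  - by apply: bounded_measurableM => //; exact: bounded_measurable_cst.
  - by move=> y; rewrite -expRD addrC; exact: IH.
rewrite expectationZ //.
(* With oscillation sqrt 2 the exponent l^2 c^2 / 4 equals l^2 / 2, the increment of the
   induction. *)
have := @hoeffding_mgf_le _ _ _ P _ (Num.sqrt 2) l bN.
rewrite sqrtr_gt0 => /(_ ltac:(by []) l0) H.
rewrite (_ : l * _ + _ = m%:R * (l ^+ 2 / 2) +
  (l * \int[P]_y iter m average sample_norm (y :: xs) + l ^+ 2 * Num.sqrt 2 ^+ 2 / 4)).
  rewrite [leRHS]expRD ler_pM2l ?expR_gt0 //; apply: H => x y.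
  rewrite lerBlDl; exact: (average_sample_norm_swap m [::]).
by rewrite sqr_sqrtr // -natr1 /average; field.
Qed.

End MeanEmbedding.

(** * Independent samples *)

Section Independence.
Variables (R : realType) (dO : measure_display) (Omega : measurableType dO).
Variable Pr : probability Omega R.
Variables (d : measure_display) (T : measurableType d) (P : probability T R).

(** The hypothesis on rectangles says that the law of the pair is the product of the law of [phi]
    and [P]; Tonelli then gives the iterated integral. *)
Lemma integral_independent_pair (dZ : measure_display) (Z : measurableType dZ)
    (phi : Omega -> Z) (Y : Omega -> T) (F : Z * T -> \bar R) :
  measurable_fun setT phi -> measurable_fun setT Y ->
  (forall A B, measurable A -> measurable B ->
    Pr (phi @^-1` A `&` Y @^-1` B) = (Pr (phi @^-1` A) * P B)%E) ->
  measurable_fun setT F -> (forall z, 0 <= F z)%E ->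
  (\int[Pr]_w F (phi w, Y w) = \int[Pr]_w \int[P]_y F (phi w, y))%E.
Proof.
move=> mphi mY ind mF F0.
pose phi' : {mfun Omega >-> Z} := HB.pack phi (isMeasurableFun.Build _ _ _ _ phi mphi).
pose psi w := (phi w, Y w).
have mpsi : measurable_fun setT psi by exact: measurable_fun_pair.
pose psi' : {mfun Omega >-> (Z * T)%type} :=
  HB.pack psi (isMeasurableFun.Build _ _ _ _ psi mpsi).
have e : forall A, measurable A -> (distribution Pr phi' \x P)%E A = distribution Pr psi' A.
  by apply: product_measure_unique => A B mA mB; exact: ind.
transitivity (\int[distribution Pr psi']_z F z)%E.
  by rewrite ge0_integral_pushforward //.
rewrite -(eq_measure_integral _ (fun A mA _ => e A mA)) fubini_tonelli1 //.
rewrite ge0_integral_pushforward //.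
  exact: measurable_fun_fubini_tonelli_F.
by move=> y _; exact: integral_ge0.
Qed.

(** The finite measures Pr(. [&] D) and Pr(D) Pr(.) agree on a pi-system containing the whole space,
    hence on the sigma-algebra it generates. *)
Lemma pi_system_independent (D : set Omega) (G : set (set Omega)) (A : set Omega) :
  measurable D -> G `<=` measurable -> setI_closed G -> G setT ->
  (forall C, G C -> Pr (C `&` D) = (Pr C * Pr D)%E) ->
  <<s G >> A -> Pr (A `&` D) = (Pr A * Pr D)%E.
Proof.
move=> mD Gm GI GT GD GA.
pose r : {nonneg R} := NngNum (fine_ge0 (measure_ge0 Pr D)).
have rE : (r%:num%:E = Pr D)%E by rewrite /= fineK // fin_num_measure.
rewrite -[LHS]/(mrestr Pr mD A) muleC -rE -[RHS]/(mscale r Pr A).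
apply: (g_sigma_algebra_measure_unique G Gm (fun=> setT)) => //.
- by rewrite bigcup_const //; exists 0%N.
- by move=> C GC; rewrite -[LHS]/(Pr (C `&` D)) GD // muleC -rE.
- move=> _; rewrite -[X in (X < _)%E]/(Pr (setT `&` D)) setTI.
  by rewrite ltey_eq fin_num_measure.
Qed.

Variables (n : nat) (X : 'I_n -> Omega -> T).
Hypothesis X_measurable : forall i, measurable_fun setT (X i).
Hypothesis X_independent : mutually_independent Pr X.
Hypothesis X_law : identically_distributed Pr P X.

(** A pi-system generating the sigma-algebra of the samples with index in [s]. *)
Definition cylinders (s : seq 'I_n) : set (set Omega) :=
  [set A | exists2 B : 'I_n -> set T, (forall j, measurable (B j)) &
    A = \bigcap_(j in [set j | j \in s]) (X j @^-1` B j)].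

Lemma cylinders_measurable s : cylinders s `<=` measurable.
Proof.
move=> _ [B mB ->]; apply: fin_bigcap_measurable => // j _.
by rewrite -[X in measurable X]setTI; exact: X_measurable.
Qed.

Lemma cylinders_setI s : setI_closed (cylinders s).
Proof.
move=> _ _ [A mA ->] [B mB ->]; exists (fun j => A j `&` B j).
  by move=> j; exact: measurableI.
by rewrite -bigcapI; apply: eq_bigcapr => j _; rewrite preimage_setI.
Qed.

Lemma cylinders_setT s : cylinders s setT.
Proof. by exists (fun=> setT) => //; rewrite bigcapT. Qed.

Lemma cylinders_independent i s A B : i \notin s -> <<s cylinders s >> A ->
  measurable B -> Pr (A `&` X i @^-1` B) = (Pr A * P B)%E.
Proof.
move=> si sA mB; rewrite -(X_law i mB).
apply: (@pi_system_independent _ (cylinders s)) => //.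
- by rewrite -[X in measurable X]setTI; exact: X_measurable.
- exact: cylinders_measurable.
- exact: cylinders_setI.
- exact: cylinders_setT.
move=> _ [C mC ->].
pose J : {set 'I_n} := [set j in s]%SET.
(* One family of sets encodes the cylinder together with the event on [X i], so independence over
   [i |: J] can be compared with independence over [J]. *)
pose C' j := if j == i then B else C j.
have mC' j : measurable (C' j) by rewrite /C'; case: ifP.
have C'E j : j \in s -> C' j = C j.
  by rewrite /C'; case: eqP => // ->; rewrite (negPf si).
have := X_independent (i |: J)%SET mC'; have := X_independent J mC.
rewrite big_setU1 /= ?inE // => e1.
have -> : (\prod_(j in J) Pr (X j @^-1` C' j) = \prod_(j in J) Pr (X j @^-1` C j))%E.
  by apply: eq_bigr => j; rewrite inE => js; rewrite C'E.
rewrite -e1 /C' eqxx => e2.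
have -> : [set j | j \in s] = [set j | j \in J].
  by apply/seteqP; split => j /=; rewrite inE.
rewrite [RHS]muleC -e2; congr (Pr _); apply/seteqP; split => [w [wC wB] j|w wC].
  rewrite /= !inE => /orP[/eqP -> |js]; first by rewrite eqxx.
  by case: eqP => [-> //|_]; apply: (wC j); rewrite /= inE.
split; last by have := wC i; rewrite /= !inE eqxx; exact.
move=> j /=; rewrite inE => js.
have := wC j; rewrite /= !inE js orbT => /(_ isT); rewrite -/(C' j) C'E //.
Qed.

Lemma integral_sample_average (F : seq T -> R) i s : admissible F -> i \notin s ->
  (\int[Pr]_w (F (X i w :: [seq X j w | j <- s]))%:E =
   \int[Pr]_w (average P F [seq X j w | j <- s])%:E)%E.
Proof.
move=> aF si; have [F0 _ mF] := aF.
(* The tail of the sample is represented by [Omega] itself under the coarser sigma-algebra of the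
   cylinders, with the identity as random variable. Admissibility, which allows any driving space,
   applies to it. *)
pose Z : measurableType _ := g_sigma_algebraType (cylinders s).
have mid : measurable_fun setT (id : Omega -> Z).
  move=> _ C GC; rewrite setTI; move: C GC; apply: smallest_sub.
    exact: sigma_algebra_measurable.
  exact: cylinders_measurable.
pose f k (z : Z * T) := if k is l.+1 then X (nth i s l) z.1 else z.2.
have fE w y : y :: [seq X j w | j <- s] = mkseq (f ^~ (w, y)) (size s).+1.
  rewrite /mkseq /= -[1%N]addn0 iotaDl -map_comp; congr (_ :: _).
  by rewrite -[in LHS](mkseq_nth i s) /mkseq -map_comp.
have mX j : j \in s -> measurable_fun setT (X j : Z -> T).
  move=> js _ B mB; rewrite setTI; apply: sub_sigma_algebra.
  exists (fun k => if k == j then B else setT); first by move=> k; case: ifP.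
  apply/seteqP; split => [w wB k _ /=|w /(_ j js)]; last by rewrite /= eqxx.
  by case: eqP => [->|].
pose H (z : Z * T) := (F (mkseq (f ^~ z) (size s).+1))%:E.
have mH : measurable_fun setT H.
  apply/measurable_EFinP; apply: mF => -[_|k] /=; first exact: measurable_snd.
  rewrite ltnS => ks; apply: measurableT_comp => //.
  by apply: mX; exact: mem_nth.
transitivity (\int[Pr]_w H (w, X i w))%E.
  by apply: eq_integral => w _; rewrite fE.
rewrite (@integral_independent_pair _ Z id (X i) H) //.
- apply: eq_integral => w _; rewrite /average /Rintegral fineK.
    by apply: eq_integral => y _; rewrite /H -fE.
  apply: integrable_fin_num => //; apply: bounded_measurable_integrable.
  exact: admissible_bounded_measurable.
- move=> A B mA mB; exact: (@cylinders_independent i s A B si mA mB).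
- by move=> z; rewrite lee_fin.
Qed.

(** Distinct indices make each head independent of its tail, so the samples are integrated out one
    by one. Expectations over [Omega] thereby become iterated averages under [P]. *)
Lemma integral_sample (F : seq T -> R) s : admissible F -> uniq s ->
  (\int[Pr]_w (F [seq X j w | j <- s])%:E = (iter (size s) (average P) F [::])%:E)%E.
Proof.
elim: s F => [|i s IH] F aF /=.
  by move=> _; rewrite integral_cst //= probability_setT mule1.
case/andP => si us; rewrite integral_sample_average // IH //; last exact: admissible_average.
by rewrite -iterSr.
Qed.

End Independence.

(** * Deviation of the empirical embedding *)

Section SampleDeviation.
Variables (R : realType) (d : measure_display) (T : measurableType d).
Variables (P : probability T R) (S : Type) (K : S -> S -> R) (iota : T -> S).
Hypothesis HK : unit_kernel K iota.

Section Tail.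
Variables (dO : measure_display) (Omega : measurableType dO) (Pr : probability Omega R).
Variables (n : nat) (X : 'I_n -> Omega -> T).
Hypothesis n_gt0 : (0 < n)%N.
Hypothesis X_measurable : forall i, measurable_fun setT (X i).
Hypothesis X_independent : mutually_independent Pr X.
Hypothesis X_law : identically_distributed Pr P X.

Let N (w : Omega) : R := sample_norm P K iota [seq X i w | i <- enum 'I_n].

Lemma measurable_sample_norm : measurable_fun setT N.
Proof.
have [_ _ mN] := admissible_sample_norm P HK.
case: n n_gt0 X X_measurable @N => // m _ Y mY N'.
have -> : N' = fun w => sample_norm P K iota
    (mkseq (fun k => Y (nth ord0 (enum 'I_m.+1) k) w) (size (enum 'I_m.+1))).
  apply/funext => w; congr sample_norm.
  by rewrite -[in LHS](mkseq_nth ord0 (enum _)) /mkseq -map_comp.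
by apply: mN => k _; exact: mY.
Qed.

Lemma sample_norm_tail (delta : R) : 0 < delta < 1 ->
  ((1 - delta)%:E <= Pr [set w | (N w < Num.sqrt n%:R * (2 + Num.sqrt (2 * ln delta^-1)))%R])%E.
Proof.
move=> /andP[d0 d1]; set L := ln delta^-1.
have L0 : 0 < L by rewrite ln_gt0 // invf_gt1.
pose a : R := Num.sqrt n%:R; pose b := Num.sqrt (2 * L).
have a0 : 0 < a by rewrite sqrtr_gt0 ltr0n.
have a2 : a ^+ 2 = n%:R by rewrite sqr_sqrtr.
have b0 : 0 < b by rewrite sqrtr_gt0 mulr_gt0.
have b2 : b ^+ 2 = 2 * L by rewrite sqr_sqrtr // mulr_ge0 // ltW.
(* The choice of [l] turns the exponent of the moment bound, l a + n l^2 / 2, into b + L, while l r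
   = 2 b + 2 L. Markov's inequality then leaves at most exp(-b - L), which is below [delta]. *)
rewrite -/a -/b; pose r := a * (2 + b); pose l := b / a.
have l0 : 0 < l by rewrite divr_gt0.
have mN := measurable_sample_norm.
pose A := [set w | r <= N w].
have mA : measurable A.
  rewrite (_ : A = N @^-1` `[r, +oo[%classic); last first.
    by apply/seteqP; split => w /=; rewrite in_itv /= andbT.
  by rewrite -[X in measurable X]setTI; exact: mN.
have -> : [set w | N w < r] = ~` A.
  by apply/seteqP; split => w /=; rewrite ltNge => /negP.
rewrite probability_setC //.
suff : (Pr A <= delta%:E)%E.
  by move=> h; rewrite EFinB leeB.
have aF : admissible (fun xs => expR (l * sample_norm P K iota xs)).
  by apply: admissible_expR; [exact: ltW|exact: admissible_sample_norm].
have := integral_sample X_measurable X_independent X_law aF (enum_uniq 'I_n).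
rewrite size_enum_ord => intE.
have mg : measurable_fun setT (fun w => (expR (l * N w))%:E).
  by apply/measurable_EFinP; apply: measurableT_comp => //; exact: measurable_funM.
(* Markov's inequality for expR (l N) at the level expR (l r). *)
have := @le_integral_comp_abse _ _ R Pr setT measurableT _ (expR (l * r)) id
  (@measurable_id _ _ setT) (fun _ h => h) (fun _ _ _ _ h => h) mg (expR_gt0 _).
rewrite setTI (_ : [set w | _] = A); last first.
  apply/seteqP; split => w /=; rewrite lee_fin ger0_norm ?expR_ge0 // ler_expR ler_pM2l //.
under eq_integral do rewrite gee0_abs ?lee_fin ?expR_ge0 //.
rewrite intE => h.
have pE : Pr A = (fine (Pr A))%:E by rewrite fineK // fin_num_measure.
move: h; rewrite /= pE -EFinM !lee_fin => h.
rewrite -(@ler_pM2l _ (expR (l * r))) ?expR_gt0 //; apply: (le_trans h).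
apply: (le_trans (average_expR_sample_norm_le P HK n [::] (ltW l0))).
rewrite -[delta]lnK ?posrE // -expRD ler_expR.
have -> : ln delta = - L by rewrite /L lnV ?posrE // opprK.
have := ler_wpM2l (ltW l0) (average_sample_norm_le P HK n); rewrite -/a => h1.
apply: (le_trans (lerD h1 (lexx _))).
have -> : n%:R * (l ^+ 2 / 2) = L.
  rewrite -a2 /l expr_div_n b2; field; exact: lt0r_neq0.
have -> : l * r = 2 * b + 2 * L.
  rewrite /r -b2 /l; field; exact: lt0r_neq0.
have -> : l * a = b by rewrite /l divfK // lt0r_neq0.
lra.
Qed.

End Tail.

Lemma comb_eval_le_norm (w : seq (R * S)) s :
  `|comb_eval K w s| <= Num.sqrt (comb_sqnorm K w).
Proof.
have := comb_ip_le_norm [:: (1, s)] w (unit_kernelC HK) (unit_kernel_pos HK).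
by rewrite (comb_ip_dirac HK) (comb_sqnorm_dirac HK) expr1n sqrtr1 !mul1r.
Qed.

(** Features have norm 1, so the norm bound dominates all evaluations by the constant [C] and
    dominated convergence applies. Measurability of [g] is obtained here, as a pointwise limit. *)
Lemma expectation_lim_comb_eval (W : nat -> seq (R * S)) (g : T -> R) (C : R) :
  (forall m, Num.sqrt (comb_sqnorm K (W m)) <= C) ->
  (forall y, comb_eval K (W m) (iota y) @[m --> \oo] --> g y) ->
  bounded_measurable g /\ comb_mean P K iota (W m) @[m --> \oo] --> \int[P]_y g y.
Proof.
move=> WC Wg.
have bW m : bounded_measurable (fun y => comb_eval K (W m) (iota y)).
  exact: (bounded_measurable_comb_eval HK).
have WC' m y : `|comb_eval K (W m) (iota y)| <= C.
  exact: le_trans (comb_eval_le_norm _ _) (WC m).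
have mg : measurable_fun setT g.
  by apply: (measurable_fun_cvg (fun m => (bW m).1)) => y _; exact: Wg.
have bg : bounded_measurable g.
  split => //; exists C => y; rewrite -(cvg_lim _ (cvg_norm (Wg y))) //.
  apply: limr_le; first by apply/cvg_ex; exists `|g y|; exact: cvg_norm (Wg y).
  by apply: nearW => m; exact: WC'.
split=> //.
have cE y : (comb_eval K (W m) (iota y))%:E @[m --> \oo] --> (g y)%:E.
  by apply: cvg_EFin; [exact: nearW|exact: Wg].
have [_ _ h] : [/\ P.-integrable setT (EFin \o g),
    (\int[P]_y `|(comb_eval K (W m) (iota y))%:E - (g y)%:E|)%E @[m --> \oo] --> 0%E &
    (\int[P]_y (comb_eval K (W m) (iota y))%:E)%E @[m --> \oo] --> (\int[P]_y (g y)%:E)%E].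
  apply: (@dominated_convergence _ T R P setT measurableT _ _ (cst C%:E)).
  - by move=> m; apply/measurable_EFinP; exact: (bW m).1.
  - exact/measurable_EFinP.
  - by apply: aeW => y _; exact: cE.
  - exact: (bounded_measurable_integrable P (bounded_measurable_cst T C)).
  - by apply: aeW => y m _; rewrite lee_fin.
have gfin : (\int[P]_y (g y)%:E)%E = (\int[P]_y g y)%:E.
  by rewrite /Rintegral fineK //; apply: integrable_fin_num => //; exact: bounded_measurable_integrable.
move: h; rewrite [X in _ --> X]gfin => /fine_cvg.
apply: cvg_trans; apply: near_eq_cvg; apply: nearW => m.
by rewrite /= -(expectation_comb_eval P HK).
Qed.

(** The deterministic half of the argument: it holds for every list [xs], and the sample affects the
    error only through [sample_norm]. *)
Lemma expectation_lim_le (W : nat -> seq (R * S)) (g : T -> R) (C : R) (xs : seq T) :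
  (forall m, Num.sqrt (comb_sqnorm K (W m)) <= C) ->
  (forall y, comb_eval K (W m) (iota y) @[m --> \oo] --> g y) ->
  (size xs)%:R * \int[P]_y g y <= \sum_(x <- xs) g x + C * sample_norm P K iota xs.
Proof.
move=> WC Wg; have [bg h] := expectation_lim_comb_eval WC Wg.
have c1 : (size xs)%:R * comb_mean P K iota (W m) @[m --> \oo] --> (size xs)%:R * \int[P]_y g y.
  by apply: cvgM => //; exact: cvg_cst.
have c2 : \sum_(x <- xs) comb_eval K (W m) (iota x) + C * sample_norm P K iota xs @[m --> \oo]
    --> \sum_(x <- xs) g x + C * sample_norm P K iota xs.
  by apply: cvgD; [exact: cvg_big_sum|exact: cvg_cst].
apply: (ler_cvg_to c1 c2); apply: nearW => m.
have := sample_norm_pairing P HK (W m) xs.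
have := ler_wpM2r (ext_norm_ge0 P K iota (sample_vec R iota xs)) (WC m).
rewrite -/(sample_norm P K iota xs) ler_norml => h1 /andP[h2 _]; lra.
Qed.

End SampleDeviation.

(** * Squared loss *)

Section SquareLoss.
Variables (R : realType) (d : nat) (sigma : R).
Hypothesis sigma_gt0 : 0 < sigma.
Local Notation T := (d.-tuple R).
Implicit Types c w : seq (R * T).

(** Doubling the centres is isometric from the kernel of width sigma / sqrt 2 to the tensor kernel
    and keeps the values on the diagonal; this transports the radii given for [f^2] and [h^2]. *)
Definition comb_diag c : seq (R * (T * T)) := [seq (p.1, (p.2, p.2)) | p <- c].

Definition comb_tensor c w : seq (R * (T * T)) :=
  [seq (p.1 * q.1, (p.2, q.2)) | p <- c, q <- w].

Lemma comb_sqnorm_diag c : comb_sqnorm (gauss_tensor sigma) (comb_diag c) =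
  comb_sqnorm (gauss_kernel (sigma / Num.sqrt 2)) c.
Proof.
rewrite /comb_sqnorm big_map; apply: eq_bigr => p _; rewrite big_map.
by apply: eq_bigr => q _ /=; rewrite gauss_kernel_div_sqrt2.
Qed.

Lemma comb_eval_diag c x : comb_eval (gauss_tensor sigma) (comb_diag c) (x, x) =
  comb_eval (gauss_kernel (sigma / Num.sqrt 2)) c x.
Proof.
rewrite /comb_eval big_map; apply: eq_bigr => p _.
by rewrite gauss_kernel_div_sqrt2.
Qed.

Lemma comb_sqnorm_tensor c w : comb_sqnorm (gauss_tensor sigma) (comb_tensor c w) =
  comb_sqnorm (gauss_kernel sigma) c * comb_sqnorm (gauss_kernel sigma) w.
Proof.
rewrite /comb_sqnorm big_allpairs_dep big_distrl /=; apply: eq_bigr => p _.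
under eq_bigr do rewrite big_allpairs_dep /=.
rewrite exchange_big big_distrl /=; apply: eq_bigr => p' _.
rewrite big_distrr /=; apply: eq_bigr => q _; rewrite big_distrr /=.
by apply: eq_bigr => q' _; rewrite /gauss_tensor /=; ring.
Qed.

Lemma comb_eval_tensor c w x : comb_eval (gauss_tensor sigma) (comb_tensor c w) (x, x) =
  comb_eval (gauss_kernel sigma) c x * comb_eval (gauss_kernel sigma) w x.
Proof.
rewrite /comb_eval big_allpairs_dep big_distrl /=; apply: eq_bigr => p _.
rewrite big_distrr /=; apply: eq_bigr => q _; rewrite /gauss_tensor /=; ring.
Qed.

Lemma gauss_tensorC (p q : T * T) : gauss_tensor sigma p q = gauss_tensor sigma q p.
Proof. by rewrite /gauss_tensor !(gauss_kernelC sigma p.1) !(gauss_kernelC sigma p.2). Qed.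

Lemma unit_kernel_gauss_tensor : unit_kernel (@gauss_tensor R d sigma) (fun x : T => (x, x)).
Proof.
split.
- exact: gauss_tensorC.
- exact: pos_def_gauss_tensor.
- by move=> s; rewrite /gauss_tensor !gauss_kernelxx mulr1.
- by move=> s t; rewrite mulr_ge0 // gauss_kernel_ge0.
- by move=> s t; rewrite mulr_ile1 // ?gauss_kernel_ge0 ?gauss_kernel_le1.
- move=> s; apply: measurable_funM.
    exact: (measurable_gauss_kernel sigma (@measurable_cst _ _ _ _ setT s.1) (@measurable_id _ _ setT)).
  exact: (measurable_gauss_kernel sigma (@measurable_cst _ _ _ _ setT s.2) (@measurable_id _ _ setT)).
- by move=> dZ Z f g mf mg; apply: measurable_funM; apply: measurable_gauss_kernel.
Qed.

Lemma square_loss_approx (f h : T -> R) (Lf2 Lf Lh2 Lh e : R) :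
  gauss_rkhs_norm_le (sigma / Num.sqrt 2) (fun x => f x ^+ 2) Lf2 ->
  gauss_rkhs_norm_le sigma f Lf ->
  gauss_rkhs_norm_le (sigma / Num.sqrt 2) (fun x => h x ^+ 2) Lh2 ->
  gauss_rkhs_norm_le sigma h Lh -> 0 < e ->
  exists W : nat -> seq (R * (T * T)),
    (forall m, Num.sqrt (comb_sqnorm (gauss_tensor sigma) (W m)) <=
      Lf2 + e + (Lh2 + e) + 2 * ((Lf + e) * (Lh + e))) /\
    (forall x, comb_eval (gauss_tensor sigma) (W m) (x, x) @[m --> \oo] -->
      (f x - h x) ^+ 2).
Proof.
move=> [u [ucv [_ /(_ e) uL]]] [a [acv [_ /(_ e) aL]]].
move=> [v [vcv [_ /(_ e) vL]]] [b [bcv [_ /(_ e) bL]]] e0.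
have [[N1 {}uL] [N2 {}aL]] := (uL e0, aL e0).
have [[N3 {}vL] [N4 {}bL]] := (vL e0, bL e0).
(* The four norm bounds hold eventually and up to [e]; shifting all sequences by a common [N] makes
   them hold at every index. *)
pose N := maxn (maxn N1 N2) (maxn N3 N4).
have [le1 le2 le3 le4] : [/\ (N1 <= N)%N, (N2 <= N)%N, (N3 <= N)%N & (N4 <= N)%N].
  by rewrite /N !leq_max !leqnn !orbT.
have tens m c w : Num.sqrt (comb_sqnorm (gauss_tensor sigma)
    (comb_scale m (comb_tensor c w))) = `|m| * (Num.sqrt (comb_sqnorm (gauss_kernel sigma) c) *
    Num.sqrt (comb_sqnorm (gauss_kernel sigma) w)).
  by rewrite comb_norm_scale comb_sqnorm_tensor sqrtrM //; exact: pos_def_gauss.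
pose W m := (comb_diag (u m) ++ comb_diag (v m)) ++ comb_scale (- 2) (comb_tensor (a m) (b m)).
exists (fun m => W (m + N)%N); split => [m|x].
  have M k : (k <= N)%N -> (k <= m + N)%N by move=> kN; rewrite (leq_trans kN) ?leq_addl.
  apply: (le_trans (comb_norm_cat _ _ gauss_tensorC (pos_def_gauss_tensor sigma_gt0))).
  apply: lerD.
    apply: (le_trans (comb_norm_cat _ _ gauss_tensorC (pos_def_gauss_tensor sigma_gt0))).
    by rewrite !comb_sqnorm_diag lerD // ?uL ?vL // M.
  rewrite tens normrN ger0_norm // ler_pM2l // ler_pM ?sqrtr_ge0 //.
    by rewrite aL // M.
  by rewrite bL // M.
rewrite (cvg_shiftn N (fun m => comb_eval (gauss_tensor sigma) (W m) (x, x))).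
rewrite (_ : _ ^+ 2 = f x ^+ 2 + h x ^+ 2 + - 2 * (f x * h x)); last by ring.
under eq_fun do rewrite !comb_eval_cat comb_eval_scale !comb_eval_diag comb_eval_tensor.
apply: cvgD; first by apply: cvgD; [exact: ucv|exact: vcv].
by apply: cvgM; [exact: cvg_cst|apply: cvgM; [exact: acv|exact: bcv]].
Qed.

End SquareLoss.

(** The form A + e (B + 2 e) is the radius of [square_loss_approx] expanded in its slack, with A = M
    and B = 2 + 2 (Lf + Lh). *)
Lemma ler_lim_perturbation (R : realFieldType) (x y A B r : R) : 0 <= r ->
  (forall e, 0 < e -> x <= y + (A + e * (B + 2 * e)) * r) -> x <= y + A * r.
Proof.
move=> r0 H; apply/ler_addgt0Pr => t t0.
(* Since e <= 1, the factor B + 2 e is at most |B| + 2; using r + 1 keeps [Q] positive when r =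
   0. *)
pose Q := (`|B| + 2) * (r + 1).
have Q0 : 0 < Q by rewrite mulr_gt0 // ltr_wpDl.
pose e := Num.min 1 (t / Q).
have e0 : 0 < e by rewrite lt_min ltr01 divr_gt0.
have e1 : e <= 1 by rewrite ge_min lexx.
have eQ : e * Q <= t by rewrite -ler_pdivlMr // ge_min lexx orbT.
apply: (le_trans (H e e0)); rewrite -addrA lerD2l mulrDl lerD2l.
apply: le_trans eQ; rewrite /Q -mulrA ler_pM2l //.
apply: (@le_trans _ _ ((`|B| + 2) * r)).
  by apply: ler_wpM2r => //; apply: lerD; [exact: ler_norm|lra].
by rewrite ler_wpM2l ?lerDl // addr_ge0.
Qed.

Theorem theorem3 (R : realType) (d : nat) (sigma : R) (hsigma : 0 < sigma)
  (dO : measure_display) (Omega : measurableType dO) (Pr : probability Omega R)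
  (P : probability (d.-tuple R) R)
  (n : nat) (hn : (0 < n)%N) (X : 'I_n -> Omega -> d.-tuple R)
  (hXmeas : forall i, measurable_fun setT (X i))
  (hXind : mutually_independent Pr X)
  (hXlaw : identically_distributed Pr P X)
  (h : d.-tuple R -> R) (Lh2 Lh Lf2 Lf : R)
  (hh2 : gauss_rkhs_norm_le (sigma / Num.sqrt 2) (fun x => h x ^+ 2) Lh2)
  (hh : gauss_rkhs_norm_le sigma h Lh)
  (delta : R) (hdelta : 0 < delta) :
  exists E : set Omega, measurable E /\ ((1 - delta)%:E <= Pr E)%E /\
    forall omega, E omega ->
    forall f : d.-tuple R -> R,
      gauss_rkhs_norm_le (sigma / Num.sqrt 2) (fun x => f x ^+ 2) Lf2 ->
      gauss_rkhs_norm_le sigma f Lf ->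
      (\int[P]_x ((f x - h x) ^+ 2)%:E <=
        ((n%:R)^-1 * \sum_(i < n) (f (X i omega) - h (X i omega)) ^+ 2
         + 2 / Num.sqrt n%:R * (1 + Num.sqrt (ln (delta^-1) / 2))
           * (Lf2 + Lh2 + 2 * Lf * Lh))%:E)%E.
Proof.
(* For [delta] at least 1 the required probability is nonpositive and the empty event serves;
   otherwise ln(1/delta) is positive. *)
have [d1|d1] := leP 1 delta.
  exists set0; split; first exact: measurable0.
  by split => //; rewrite measure0 lee_fin subr_le0.
set L := ln _.
have L0 : 0 < L by rewrite ln_gt0 // invf_gt1.
have HK := @unit_kernel_gauss_tensor R d sigma hsigma.
pose r := Num.sqrt n%:R * (2 + Num.sqrt (2 * L)).
have r0 : 0 <= r by rewrite mulr_ge0 ?addr_ge0 ?sqrtr_ge0.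
pose N w := sample_norm P (gauss_tensor sigma) (fun x => (x, x)) [seq X i w | i <- enum 'I_n].
(* The event involves the sample and [P] but neither [f] nor a slack, hence the uniformity in
   [f]. *)
exists [set w | N w < r]; split.
  rewrite (_ : [set w | _] = N @^-1` `]-oo, r[%classic); last first.
    by apply/seteqP; split => w /=; rewrite in_itv.
  rewrite -[X in measurable X]setTI; apply: (measurable_sample_norm P HK hn hXmeas) => //.
split; first by apply: (sample_norm_tail HK hn hXmeas hXind hXlaw); rewrite hdelta.
move=> w Nw f hf2 hf.
pose g x := (f x - h x) ^+ 2.
set M := Lf2 + Lh2 + 2 * Lf * Lh.
have key e : 0 < e -> n%:R * \int[P]_x g x <=
    \sum_(i < n) g (X i w) + (M + e * (2 + 2 * (Lf + Lh) + 2 * e)) * r.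
  move=> e0; have [W [WC Wg]] := square_loss_approx hsigma hf2 hf hh2 hh e0.
  have := expectation_lim_le P HK [seq X i w | i <- enum 'I_n] WC Wg.
  rewrite size_map size_enum_ord big_map big_enum /= => /le_trans; apply.
  rewrite lerD2l (_ : Lf2 + e + _ + _ = M + e * (2 + 2 * (Lf + Lh) + 2 * e)); last by rewrite /M; ring.
  apply: ler_wpM2l; last exact: ltW.
  (* The radii come without a sign; the perturbed radius is nonnegative because it bounds a norm. *)
  have := WC 0%N; move/(le_trans (sqrtr_ge0 _)).
  by rewrite (_ : Lf2 + e + _ + _ = M + e * (2 + 2 * (Lf + Lh) + 2 * e)) // /M; ring.
have {}key := ler_lim_perturbation r0 key.
have gfin : (\int[P]_x (g x)%:E)%E = (\int[P]_x g x)%:E.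
  (* The slack 1 is arbitrary: only boundedness and measurability of [g] are extracted. *)
  have [W [WC Wg]] := square_loss_approx hsigma hf2 hf hh2 hh ltr01.
  have [bg _] := expectation_lim_comb_eval P HK WC Wg.
  rewrite /Rintegral fineK //; apply: integrable_fin_num => //.
  exact: bounded_measurable_integrable.
rewrite gfin lee_fin -(@ler_pM2l _ n%:R) ?ltr0n //; apply: (le_trans key).
rewrite mulrDr mulVKf ?pnatr_eq0 -?lt0n // lerD2l.
have a0 : 0 < Num.sqrt n%:R :> R by rewrite sqrtr_gt0 ltr0n.
(* This turns 2 + sqrt(2 L) into 2 (1 + sqrt(L / 2)), the form of the stated constant. *)
have sqE : Num.sqrt (2 * L) = 2 * Num.sqrt (L / 2).
  rewrite (_ : 2 * L = 2 ^+ 2 * (L / 2)); last by field.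
  by rewrite sqrtrM ?sqr_ge0 // sqrtr_sqr ger0_norm.
have -> : n%:R = Num.sqrt n%:R ^+ 2 :> R by rewrite sqr_sqrtr.
rewrite sqrtr_sqr ger0_norm ?(ltW a0) // /r sqE le_eqVlt; apply/orP; left; apply/eqP.
by field; exact: lt0r_neq0.
Qed.
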